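(* Let $G$ be a group and let $N$ and $M$ be two normal subgroups of $G$ contained in a subgroup $H$ of $G$. Then: (1) There is a surjective group homomorphism $$\underline{\operatorname{Apr}}_{G/(N\cap M)}(H/(N\cap M))\to \underline{\operatorname{Apr}}_{G/N}(H/N),\qquad x(N\cap M)\mapsto xN,$$ with kernel equal to $N/(N\cap M)$. (2) There is a surjective group homomorphism $$\underline{\operatorname{Apr}}_{G/N}(H/N)\to \underline{\operatorname{Apr}}_{G/NM}(H/NM),\qquad xN\mapsto x(NM),$$ with kernel equal to $NM/N$. (3) There is a surjective group homomorphism $$\underline{\operatorname{Apr}}_{G/(N\cap M)}(H/(N\cap M))\to \underline{\operatorname{Apr}}_{G/NM}(H/NM),\qquad x(N\cap M)\mapsto xNM,$$ with kernel equal to $NM/(N\cap M)$.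
   Context: For a group $G$ and a normal subgroup $P$ of $G$, conjugacy on $G/P$ is the relation $xP\sim yP$ iff $xP=(aya^{-1})P$ for some $a\in G$; the class of $xP$ is $[xP]=\{(axa^{-1})P : a\in G\}$. For a subset $H\subseteq G$ with $P\subseteq H$, $H/P:=\{hP : h\in H\}\subseteq G/P$, and the lower approximation of $H/P$ is $\underline{\operatorname{Apr}}_{G/P}(H/P)=\{xP\in G/P : [xP]\subseteq H/P\}$. When $H$ is a subgroup, this is a normal subgroup of $G/P$, and it is regarded as a group in this way. Here $NM=\{nm : n\in N, m\in M\}$. *)

(* Defs.v *)
From HB Require Import structures.
From mathcomp Require Import all_boot.
From mathcomp Require Import boolp.

Set Implicit Arguments.
Unset Strict Implicit.
Unset Printing Implicit Defensive.

Local Open Scope group_scope.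
Local Open Scope quotient_scope.

(* Subgroups of an arbitrary (possibly infinite) group are MathComp's
   [groupClosed]; normal subgroups add stability under conjugation. Predicates
   are boolean, classically: [`[< P >]] reflects [P : Prop]. *)

HB.mixin Record isConjClosed (G : groupType) (S : {pred G}) := {
  gpredJr : forall x y : G, x \in S -> x ^ y \in S
}.

#[short(type="normalClosed")]
HB.structure Definition NormalClosed (G : groupType) :=
  {S of GroupClosed G S & isConjClosed G S}.

Section Subsets.
Variable G : groupType.

Definition capg (A B : {pred G}) : {pred G} := fun x => (x \in A) && (x \in B).

Definition prodg (A B : {pred G}) : {pred G} :=
  fun x => `[< exists a b : G, [/\ a \in A, b \in B & x = a * b] >].

Variables N M : normalClosed G.

Fact capg_mul : mulg_closed (capg N M).
Proof.
move=> x y /andP[xN xM] /andP[yN yM].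
by apply/andP; split; apply: gpredM.
Qed.

Fact capg_one : 1 \in capg N M.
Proof. by apply/andP; split; apply: gpred1. Qed.

Fact capg_inv : invg_closed (capg N M).
Proof. by move=> x /andP[xN xM]; apply/andP; split; apply: gpredVr. Qed.

Fact capg_conj (x y : G) : x \in capg N M -> x ^ y \in capg N M.
Proof. by move=> /andP[xN xM]; apply/andP; split; apply: gpredJr. Qed.

HB.instance Definition _ := isMulClosed.Build G (capg N M) capg_mul.
HB.instance Definition _ := isMul1Closed.Build G (capg N M) capg_one.
HB.instance Definition _ := isInvClosed.Build G (capg N M) capg_inv.
HB.instance Definition _ := isConjClosed.Build G (capg N M) capg_conj.

Fact prodg_mul : mulg_closed (prodg N M).
Proof.
move=> x y /asboolP[a [b [aN bM ->]]] /asboolP[c [d [cN dM ->]]].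
apply/asboolP; exists (a * c ^ b^-1), (b * d); split.
- by apply: gpredM => //; apply: gpredJr.
- exact: gpredM.
- by rewrite /conjg invgK !mulgA mulgVK.
Qed.

Fact prodg_one : 1 \in prodg N M.
Proof.
by apply/asboolP; exists 1, 1; split; rewrite ?mulg1 //; apply: gpred1.
Qed.

Fact prodg_inv : invg_closed (prodg N M).
Proof.
move=> x /asboolP[a [b [aN bM ->]]].
apply/asboolP; exists (a^-1 ^ b), b^-1; split.
- by apply: gpredJr; apply: gpredVr.
- exact: gpredVr.
- by rewrite /conjg invgM !mulgA mulgK.
Qed.

Fact prodg_conj (x y : G) : x \in prodg N M -> x ^ y \in prodg N M.
Proof.
move=> /asboolP[a [b [aN bM ->]]].
apply/asboolP; exists (a ^ y), (b ^ y); split; try exact: gpredJr.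
by rewrite conjMg.
Qed.

HB.instance Definition _ := isMulClosed.Build G (prodg N M) prodg_mul.
HB.instance Definition _ := isMul1Closed.Build G (prodg N M) prodg_one.
HB.instance Definition _ := isInvClosed.Build G (prodg N M) prodg_inv.
HB.instance Definition _ := isConjClosed.Build G (prodg N M) prodg_conj.

End Subsets.

Section Quotient.
Variables (G : groupType) (P : normalClosed G).

Definition coset_rel : rel G := fun x y => x^-1 * y \in P.

Fact coset_rel_refl : reflexive coset_rel.
Proof. by move=> x; rewrite /coset_rel mulVg gpred1. Qed.

Fact coset_rel_sym : symmetric coset_rel.
Proof. by move=> x y; rewrite /coset_rel -gpredV invgM invgK. Qed.

Fact coset_rel_trans : transitive coset_rel.
Proof.
move=> y x z xy yz; rewrite /coset_rel.
by have := gpredM _ _ xy yz; rewrite mulgA mulgK.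
Qed.

Canonical coset_equiv :=
  EquivRel coset_rel coset_rel_refl coset_rel_sym coset_rel_trans.

Definition quotg : Type := {eq_quot coset_equiv}.
HB.instance Definition _ := Choice.on quotg.

(* [cosetg x] is the element xP of G/P. *)
Definition cosetg (x : G) : quotg := \pi_({eq_quot coset_equiv}) x.

Lemma cosetgP (x y : G) : reflect (cosetg x = cosetg y) (x^-1 * y \in P).
Proof. exact: (@eqquotP _ coset_equiv _ x y). Qed.

Definition reprg (X : quotg) : G := repr (X : {eq_quot coset_equiv}).

Lemma reprgK : cancel reprg cosetg.
Proof. by move=> X; rewrite /cosetg /reprg reprK. Qed.

Definition quotg_mul (X Y : quotg) : quotg := cosetg (reprg X * reprg Y).
Definition quotg_inv (X : quotg) : quotg := cosetg (reprg X)^-1.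

Fact quotg_mulE (x y : G) :
  quotg_mul (cosetg x) (cosetg y) = cosetg (x * y).
Proof.
apply/cosetgP; set x' := reprg _; set y' := reprg _.
have xP : x'^-1 * x \in P by apply/cosetgP; rewrite reprgK.
have yP : y'^-1 * y \in P by apply/cosetgP; rewrite reprgK.
have -> : (x' * y')^-1 * (x * y) = (x'^-1 * x) ^ y' * (y'^-1 * y).
  by rewrite /conjg invgM !mulgA mulgK.
by apply: gpredM => //; apply: gpredJr.
Qed.

Fact quotg_invE (x : G) : quotg_inv (cosetg x) = cosetg x^-1.
Proof.
apply/cosetgP; set x' := reprg _; rewrite invgK.
have xP : x^-1 * x' \in P by apply/cosetgP; rewrite reprgK.
have -> : x' * x^-1 = (x^-1 * x') ^ x^-1 by rewrite /conjg invgK !mulgA mulgV mul1g.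
exact: gpredJr.
Qed.

Fact quotg_mulA : associative quotg_mul.
Proof.
move=> X Y Z; rewrite -(reprgK X) -(reprgK Y) -(reprgK Z).
by rewrite !quotg_mulE mulgA.
Qed.

Fact quotg_mul1g : left_id (cosetg 1) quotg_mul.
Proof. by move=> X; rewrite -(reprgK X) quotg_mulE mul1g. Qed.

Fact quotg_mulg1 : right_id (cosetg 1) quotg_mul.
Proof. by move=> X; rewrite -(reprgK X) quotg_mulE mulg1. Qed.

Fact quotg_mulVg : left_inverse (cosetg 1) quotg_inv quotg_mul.
Proof. by move=> X; rewrite -(reprgK X) quotg_invE quotg_mulE mulVg. Qed.

Fact quotg_mulgV : right_inverse (cosetg 1) quotg_inv quotg_mul.
Proof. by move=> X; rewrite -(reprgK X) quotg_invE quotg_mulE mulgV. Qed.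

HB.instance Definition _ := isGroup.Build quotg
  quotg_mulA quotg_mul1g quotg_mulg1 quotg_mulVg quotg_mulgV.

Fact cosetgM : {morph cosetg : x y / x * y}.
Proof. by move=> x y; rewrite -[LHS]quotg_mulE. Qed.

HB.instance Definition _ := isMultiplicative.Build G quotg cosetg cosetgM.

Fact cosetg1 : cosetg 1 = 1.
Proof. by []. Qed.

Fact cosetgV (x : G) : cosetg x^-1 = (cosetg x)^-1.
Proof. by rewrite -[LHS]quotg_invE. Qed.

(* [quotset H] is H/P, a subset of G/P. *)
Definition quotset (H : {pred G}) : {pred quotg} :=
  fun X => `[< exists2 h, h \in H & X = cosetg h >].

(* [conj_class X] is [xP], for X = xP. *)
Definition conj_class (X : quotg) : {pred quotg} :=
  fun Y => `[< exists x a : G, X = cosetg x /\ Y = cosetg (a * x * a^-1) >].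

Definition lower_apr (A : {pred quotg}) : {pred quotg} :=
  fun X => `[< {subset conj_class X <= A} >].

Lemma quotsetP (H : {pred G}) (X : quotg) :
  reflect (exists2 h, h \in H & X = cosetg h) (X \in quotset H).
Proof. exact: asboolP. Qed.

Lemma conj_classP (X Y : quotg) :
  reflect (exists A, Y = A * X * A^-1) (Y \in conj_class X).
Proof.
apply: (iffP (asboolP _)) => [[x [a [-> ->]]]|[A ->]].
  by exists (cosetg a); rewrite !cosetgM cosetgV.
exists (reprg X), (reprg A).
by rewrite !cosetgM cosetgV !reprgK.
Qed.

Lemma lower_aprP (A : {pred quotg}) (X : quotg) :
  reflect (forall B, B * X * B^-1 \in A) (X \in lower_apr A).
Proof.
apply: (iffP (asboolP _)) => [sXA B|XA Y /conj_classP[B ->] //].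
by apply/sXA/conj_classP; exists B.
Qed.

Section QuotSubgroup.
Variable H : groupClosed G.

Fact quotset_mul : mulg_closed (quotset H).
Proof.
move=> _ _ /quotsetP[x xH ->] /quotsetP[y yH ->].
by apply/quotsetP; exists (x * y); rewrite ?cosetgM ?gpredM.
Qed.

Fact quotset_one : 1 \in quotset H.
Proof. by apply/quotsetP; exists 1; rewrite ?gpred1. Qed.

Fact quotset_inv : invg_closed (quotset H).
Proof.
move=> _ /quotsetP[x xH ->].
by apply/quotsetP; exists x^-1; rewrite ?cosetgV ?gpredV.
Qed.

HB.instance Definition _ := isMulClosed.Build quotg (quotset H) quotset_mul.
HB.instance Definition _ := isMul1Closed.Build quotg (quotset H) quotset_one.
HB.instance Definition _ := isInvClosed.Build quotg (quotset H) quotset_inv.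
End QuotSubgroup.

Section AprSubgroup.
Variable A : groupClosed quotg.

Fact lower_apr_mul : mulg_closed (lower_apr A).
Proof.
move=> X Y /lower_aprP XA /lower_aprP YA; apply/lower_aprP => B.
have -> : B * (X * Y) * B^-1 = (B * X * B^-1) * (B * Y * B^-1).
  by rewrite !mulgA mulgVK.
exact: gpredM.
Qed.

Fact lower_apr_one : 1 \in lower_apr A.
Proof. by apply/lower_aprP => B; rewrite mulg1 mulgV gpred1. Qed.

Fact lower_apr_inv : invg_closed (lower_apr A).
Proof.
move=> X /lower_aprP XA; apply/lower_aprP => B.
have -> : B * X^-1 * B^-1 = (B * X * B^-1)^-1.
  by rewrite !invgM invgK mulgA.
exact: gpredVr.
Qed.

Fact lower_apr_conj (X Y : quotg) : X \in lower_apr A -> X ^ Y \in lower_apr A.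
Proof.
move=> /lower_aprP XA; apply/lower_aprP => B.
have -> : B * X ^ Y * B^-1 = (B * Y^-1) * X * (B * Y^-1)^-1.
  by rewrite /conjg invgM invgK !mulgA.
exact: XA.
Qed.

HB.instance Definition _ := isMulClosed.Build quotg (lower_apr A) lower_apr_mul.
HB.instance Definition _ := isMul1Closed.Build quotg (lower_apr A) lower_apr_one.
HB.instance Definition _ := isInvClosed.Build quotg (lower_apr A) lower_apr_inv.
HB.instance Definition _ := isConjClosed.Build quotg (lower_apr A) lower_apr_conj.
End AprSubgroup.

End Quotient.

Arguments cosetg {G} P x.
Arguments quotset {G} P H.

(* A subgroup S of Q regarded as a group in its own right. *)
Section Subgroup.
Variables (Q : groupType) (S : groupClosed Q).

Definition subgrp : Type := {x : Q | x \in S}.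
HB.instance Definition _ := SubChoice.on subgrp.

Fact subgrp_closed : group_closed (fun x : Q => x \in S).
Proof. by split=> [|x y xS yS]; [apply: gpred1 | apply: gpredF]. Qed.

HB.instance Definition _ :=
  SubChoice_isSubGroup.Build Q (fun x => x \in S) subgrp subgrp_closed.

(* The kernel of f : S -> R, as a subset of the ambient group Q. *)
Definition kernel (R : groupType) (f : subgrp -> R) : {pred Q} :=
  fun x => `[< exists2 u : subgrp, val u = x & f u = 1 >].
End Subgroup.

(* [Apr P H] is the group of the lower approximation of H/P in G/P. *)
Notation Apr P H := (subgrp (lower_apr (quotset P H))).

(* Main.v *)
Require Import Defs.
From mathcomp Require Import all_boot.
From mathcomp Require Import boolp.
From HB Require Import structures.

(** The three maps are instances of one fact about normal subgroups P and Q of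
    G with P contained in Q and Q contained in H.

    A coset xP belongs to the lower approximation of H/P exactly when every
    conjugate of x lies in H ([mem_lower_apr]): since P is contained in H, a
    coset of P that meets H lies inside H.  This condition on x no longer
    mentions P.  Hence the projection G/P -> G/Q, given by xP |-> xQ, sends
    the lower approximation of H/P into that of H/Q, and onto it, because xQ in
    the target is the image of xP, which lies in the source.  The kernel of the
    projection is Q/P, and it lies entirely in the lower approximation of H/P,
    because Q is normal and contained in H; so restricting the projection does
    not shrink its kernel ([lower_apr_projection]).

    The theorem applies this to the inclusion of the intersection of N and M in
    N, to the inclusion of N in NM, and to the composite of the two; NM is
    contained in H because H is closed under products. *)

Set Implicit Arguments.
Unset Strict Implicit.
Unset Printing Implicit Defensive.

Local Open Scope group_scope.

(** If a x a^-1 P = h P with h in H, then a x a^-1 itself lies in h P, which is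
    contained in H.  As the condition on x does not involve P, this criterion
    transfers membership between quotients by different subgroups of H. *)
Lemma mem_lower_apr (G : groupType) (P : normalClosed G) (H : groupClosed G)
    (PH : {subset P <= H}) (x : G) :
  reflect (forall a : G, a * x * a^-1 \in H)
          (cosetg P x \in lower_apr (quotset P H)).
Proof.
apply: (iffP (lower_aprP _ _)) => [xH a | xH B].
  have /quotsetP[h hH] := xH (cosetg P a).
  rewrite -cosetgV -!cosetgM => /esym/cosetgP hP.
  by rewrite -[_ * a^-1](mulVKg h); apply: gpredM => //; apply: PH.
rewrite -(reprgK B) -cosetgV -!cosetgM.
by apply/quotsetP; exists (reprg B * x * (reprg B)^-1).
Qed.

Lemma cosetg_eq1 (G : groupType) (P : normalClosed G) (x : G) :
  reflect (cosetg P x = 1) (x \in P).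
Proof.
rewrite -cosetg1 -gpredV -[x^-1]mulg1.
exact: cosetgP.
Qed.

Lemma cosetg_subset (G : groupType) (P Q : normalClosed G)
    (PQ : {subset P <= Q}) (x y : G) :
  cosetg P x = cosetg P y -> cosetg Q x = cosetg Q y.
Proof. by move/cosetgP/PQ/cosetgP. Qed.

(** The third isomorphism theorem, in the form of a surjection with known
    kernel, restricted to lower approximations.  Both the restriction and its
    surjectivity come from [mem_lower_apr], read at the same x for P and for Q. *)
Lemma lower_apr_projection (G : groupType) (P Q : normalClosed G)
    (H : groupClosed G) (PQ : {subset P <= Q}) (QH : {subset Q <= H}) :
  exists f : {multiplicative Apr P H -> Apr Q H},
    [/\ forall (u : Apr P H) (x : G),
          val u = cosetg P x -> val (f u) = cosetg Q x,
        forall v : Apr Q H, exists u, f u = v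
      & kernel f =i quotset P Q].
Proof.
have PH : {subset P <= H} by move=> x /PQ /QH.
have f_mem (u : Apr P H) :
    cosetg Q (reprg (val u)) \in lower_apr (quotset Q H).
  apply/(mem_lower_apr QH)/(mem_lower_apr PH).
  by rewrite reprgK (valP u).
pose f (u : Apr P H) : Apr Q H := Sub (cosetg Q (reprg (val u))) (f_mem u).
have fE (u : Apr P H) (x : G) : val u = cosetg P x -> val (f u) = cosetg Q x.
  by move=> ux; rewrite SubK; apply: (cosetg_subset PQ); rewrite reprgK.
have fM : {morph f : u v / u * v}.
  move=> u v; apply: val_inj.
  rewrite (fE _ (reprg (val u) * reprg (val v))) ?cosetgM //.
  by rewrite !reprgK.
pose mf := isMultiplicative.Build _ _ f fM.
pose F : {multiplicative Apr P H -> Apr Q H} := HB.pack f mf.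
exists F; split=> [//| v | X].
  have uH : cosetg P (reprg (val v)) \in lower_apr (quotset P H).
    apply/(mem_lower_apr PH)/(mem_lower_apr QH).
    by rewrite reprgK (valP v).
  exists (Sub (cosetg P (reprg (val v))) uH : Apr P H); apply: val_inj.
  by rewrite (fE _ (reprg (val v))) ?SubK // reprgK.
apply/asboolP/quotsetP => [[u <- fu1] | [q qQ ->]].
  exists (reprg (val u)); last by rewrite reprgK.
  by apply/cosetg_eq1; rewrite -(fE u) ?reprgK // [f u]fu1.
(* Conjugates of q stay in Q, so the kernel Q/P of the unrestricted projection
   lies in the lower approximation. *)
have qH : cosetg P q \in lower_apr (quotset P H).
  apply/(mem_lower_apr PH) => a; apply: QH.
  by have := gpredJr q a^-1 qQ; rewrite /conjg invgK mulgA.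
exists (Sub (cosetg P q) qH : Apr P H) => //; apply: val_inj.
by rewrite (fE _ q) //; apply/cosetg_eq1.
Qed.

Theorem corollary3p5 (G : groupType) (N M : normalClosed G) (H : groupClosed G)
    (NH : {subset N <= H}) (MH : {subset M <= H}) :
  [/\ exists f : {multiplicative Apr (capg N M) H -> Apr N H},
        [/\ forall (u : Apr (capg N M) H) (x : G),
              val u = cosetg (capg N M) x -> val (f u) = cosetg N x,
            forall v : Apr N H, exists u, f u = v
          & kernel f =i quotset (capg N M) N],
      exists f : {multiplicative Apr N H -> Apr (prodg N M) H},
        [/\ forall (u : Apr N H) (x : G),
              val u = cosetg N x -> val (f u) = cosetg (prodg N M) x,
            forall v : Apr (prodg N M) H, exists u, f u = v
          & kernel f =i quotset N (prodg N M)]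
    & exists f : {multiplicative Apr (capg N M) H -> Apr (prodg N M) H},
        [/\ forall (u : Apr (capg N M) H) (x : G),
              val u = cosetg (capg N M) x -> val (f u) = cosetg (prodg N M) x,
            forall v : Apr (prodg N M) H, exists u, f u = v
          & kernel f =i quotset (capg N M) (prodg N M)]].
Proof.
have capN : {subset capg N M <= N} by move=> x /andP[].
have Nprod : {subset N <= prodg N M}.
  by move=> x xN; apply/asboolP; exists x, 1; rewrite mulg1 gpred1.
have prodH : {subset prodg N M <= H}.
  by move=> _ /asboolP[a [b [/NH aH /MH bH ->]]]; apply: gpredM.
split; apply: lower_apr_projection => //.
by move=> x /capN /Nprod.
Qed.
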